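(* Suppose $|\mathcal{I}_L|\ge k$ and $i_0\in\{0,1,\dots,k-1\}$. Based on any separation inequality $w\ge\sum_{i=1}^{i_0}\rho_ix_i+\sum_{i=i_0+1}^{|\mathcal{I}_L|}\psi x_i$ that is facet-defining for $\mathrm{conv}(\mathcal{P}^1_k(\mathcal{I}_L))$, the lower-separation inequality (lower-SI) $$w\ge\sum_{i=1}^{i_0}\rho_ix_i+\sum_{i=i_0+1}^{|\mathcal{I}_L|}\psi x_i+\sum_{j=|\mathcal{I}_L|+1}^n\eta_jx_j$$ with coefficients $$\eta_j=\begin{cases}\eta^{[k-1]},& j=|\mathcal{I}_L|+1,\\ \min\{\eta_{j-1},\ \eta^{[k-1-s]\cup H^{s}}\},& j=|\mathcal{I}_L|+1+s,\ s\in[n-1-|\mathcal{I}_L|],\end{cases}$$ is facet-defining for $\mathrm{conv}(\mathcal{P}^2_k)$.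
   Context: $[j]=\{1,\dots,j\}$ for integers $j\ge1$, and $[0]=\emptyset$. $N=[n]$, $k\ge1$, and $f:\mathbb{R}\to\mathbb{R}$ is concave with $f(0)=0$. The weight vector $a\in\mathbb{R}^n_+$ has exactly two distinct values $0\le a_L<a_H$; the items are indexed so that $\mathcal{I}_L=\{i:a_i=a_L\}=\{1,\dots,|\mathcal{I}_L|\}$ and $\mathcal{I}_H=\{i:a_i=a_H\}=\{|\mathcal{I}_L|+1,\dots,n\}$. $H^s=\{|\mathcal{I}_L|+1,\dots,|\mathcal{I}_L|+s\}$ is the set of the first $s$ higher-weighted items ($H^0=\emptyset$). The sets are $\mathcal{P}^2_k=\{(w,x)\in\mathbb{R}\times\{0,1\}^n: w\ge f(\sum_{i=1}^na_ix_i),\ \sum_{i=1}^nx_i\le k\}$ and $\mathcal{P}^1_k(\mathcal{I}_L)=\{(w,x)\in\mathbb{R}\times\{0,1\}^{\mathcal{I}_L}: w\ge f(a_L\sum_{i\in\mathcal{I}_L}x_i),\ \sum_{i\in\mathcal{I}_L}x_i\le k\}$. In the separation inequality, $\rho_i=f(ia_L)-f((i-1)a_L)$ and $\psi=\frac{f(ka_L)-f(i_0a_L)}{k-i_0}$ (the items of $\mathcal{I}_L$ being taken in their natural order). For a set $X$ of items preceding the item being lifted, $$\eta^X=f\Big(a_H+\sum_{i\in X}a_i\Big)-\sum_{i\in X,\,i\le i_0}\rho_i-\sum_{i\in X,\,i_0<i\le |\mathcal{I}_L|}\psi-\sum_{i\in X,\,i>|\mathcal{I}_L|}\eta_i ,$$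 which is the best objective value, at the solution with support $X$, of the lifting problem that minimizes $w-\sum_{i=1}^{i_0}\rho_ix_i-\sum_{i=i_0+1}^{|\mathcal{I}_L|}\psi x_i-\sum_{i=|\mathcal{I}_L|+1}^{j-1}\eta_ix_i$ subject to $w\ge f(a_H+\sum_{i=1}^{j-1}a_ix_i)$, $\sum_{i=1}^{j-1}x_i\le k-1$, $x\in\{0,1\}^{j-1}$. The coefficients $\eta_j$ are computed sequentially for $j=|\mathcal{I}_L|+1,\dots,n$.
   Formalization: For s ≥ k the set [k-1-s] is undefined (and reading it as empty makes the claim false), so the coefficient is taken to be η_j = η_{j-1} there, the support containing H^s being infeasible for the lifting problem. *)

(* Defs.v *)
From HB Require Import structures.
From mathcomp Require Import all_boot all_order all_algebra.
From mathcomp Require Import boolp classical_sets interval_inference reals convex.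

Set Implicit Arguments.
Unset Strict Implicit.
Unset Printing Implicit Defensive.

Import Order.TTheory GRing.Theory Num.Theory.
Local Open Scope ring_scope.

Definition concave_function (R : realType) (f : R -> R) : Prop :=
  @convex_function R R^o setT (fun x => - f x).

Section Polyhedral.
Variables (R : realType) (V : vectType R).
Local Open Scope classical_set_scope.

Definition conv_hull (S : set V) : set V :=
  \bigcap_(C in [set C : set V | convex_set C /\ S `<=` C]) C.

Definition affinely_independent (s : seq V) : bool :=
  if s is x :: t then free [seq y - x | y <- t] else true.

(* One less than the maximal number of affinely independent points; the
   dimension of the empty set is -1. *)
Definition has_affine_dim (S : set V) (d : int) : Prop :=
  (exists s : seq V, [/\ {in s, forall p, S p}, affinely_independent s
                       & (size s)%:Z = d + 1]) /\
  (forall s : seq V, {in s, forall p, S p} -> affinely_independent s ->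
     (size s)%:Z <= d + 1).

End Polyhedral.

(* Points (w, x) of R x R^I; R^o gives the structure of a vector space over R. *)
Notation point R I := (R^o * {ffun I -> R^o})%type.

(* The inequality w >= \sum_i c_i x_i defines a facet of the convex set S. *)
Definition facet_defining (R : realType) (I : finType)
    (S : set (point R I)) (c : I -> R) : Prop :=
  (forall p, S p -> \sum_i c i * p.2 i <= p.1) /\
  exists d : int, has_affine_dim S d /\
    has_affine_dim [set p : point R I | S p /\ p.1 = \sum_i c i * p.2 i]%classic (d - 1).

Section MixedIntegerSets.
Variables (R : realType) (f : R -> R) (k : nat).

Definition P2 (I : finType) (a : I -> R) : set (point R I) :=
  [set p : point R I | [/\ forall i, p.2 i = 0 \/ p.2 i = 1,
               f (\sum_i a i * p.2 i) <= p.1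
             & \sum_i p.2 i <= k%:R]]%classic.

Definition P1 (aL : R) (I : finType) : set (point R I) :=
  [set p : point R I | [/\ forall i, p.2 i = 0 \/ p.2 i = 1,
               f (aL * \sum_i p.2 i) <= p.1
             & \sum_i p.2 i <= k%:R]]%classic.

End MixedIntegerSets.

(* The items 1, ..., n are the elements of 'I_n, the ordinal i being the item
   number i.+1. *)
Definition first_items (n m : nat) : {set 'I_n} :=
  [set i : 'I_n | i.+1 <= m]%N.

Definition lower_items (R : realType) (n : nat) (a : 'I_n -> R) (aL : R) :
  {set 'I_n} := [set i | a i == aL].

Definition higher_first_items (n nL s : nat) : {set 'I_n} :=
  [set i : 'I_n | nL < i.+1 <= nL + s]%N.

Section LowerSeparation.
Variables (R : realType) (f : R -> R) (aL : R) (k i0 : nat).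

Definition rho (i : nat) : R := f (i%:R * aL) - f ((i%:R - 1) * aL).

Definition psi : R := (f (k%:R * aL) - f (i0%:R * aL)) / (k%:R - i0%:R).

(* Coefficient of the lower-weighted item number i, counted from 1. *)
Definition separation_coef (i : nat) : R := if (i <= i0)%N then rho i else psi.

Variables (n : nat) (a : 'I_n -> R) (aH : R).
Let nL : nat := #|lower_items a aL|.

Definition eta_of_support (eta : 'I_n -> R) (X : {set 'I_n}) : R :=
  f (aH + \sum_(i in X) a i)
  - \sum_(i in X | (i.+1 <= i0)%N) rho i.+1
  - \sum_(i in X | (i0 < i.+1 <= nL)%N) psi
  - \sum_(i in X | (nL < i.+1)%N) eta i.

(* For s > k - 1 a support containing s higher-weighted items violates the
   constraint \sum_i x_i <= k - 1 of the lifting problem (and [k - 1 - s] is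
   not defined), so the minimum is then over eta_(j-1) alone. *)
Definition lower_SI_lifting (eta : 'I_n -> R) : Prop :=
  [/\ forall j : 'I_n, j.+1 = (nL + 1)%N ->
        eta j = eta_of_support eta (first_items n (k - 1)),
      forall (s : nat) (j' j : 'I_n), j = j'.+1 :> nat ->
        j.+1 = (nL + 1 + s)%N -> (1 <= s <= k - 1)%N ->
        eta j = Num.min (eta j')
                  (eta_of_support eta (first_items n (k - 1 - s)
                                       :|: higher_first_items n nL s))
    & forall (s : nat) (j' j : 'I_n), j = j'.+1 :> nat ->
        j.+1 = (nL + 1 + s)%N -> (1 <= s)%N -> (k - 1 < s)%N ->
        eta j = eta j'].

End LowerSeparation.

(* Main.v *)
(* For L(m) the sum of the first m lower-weighted coefficients and E(p) that of
   the first p lifted ones, both sequences of coefficients are nonincreasing, so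
   a solution with m lower- and p higher-weighted items satisfies the inequality
   as soon as L(m) + E(p) <= F(m, p) := f(m aL + p aH).  By concavity
   F(m, p) - L(m) is smallest at m = k - p, and there the bound is the very
   definition of the p-th lifted coefficient.
   For the dimension, the tight points of the base facet are extended by zero,
   and each higher-weighted item j contributes a tight support whose last item
   is j: the one defining eta_j if the minimum is attained there, and otherwise
   the support of j - 1 with j - 1 exchanged for j. *)

Require Import Defs.
From HB Require Import structures.
From mathcomp Require Import all_boot all_order all_algebra.
From mathcomp Require Import boolp classical_sets interval_inference reals convex.
From mathcomp Require Import ring lra zify.
(* Restores the notation [point], which classical_sets shadows. *)
Import Defs.

Set Implicit Arguments.
Unset Strict Implicit.
Unset Printing Implicit Defensive.

Import Order.TTheory GRing.Theory Num.Theory.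
Local Open Scope ring_scope.

Section AffineIndependence.
Variables (R : realType) (V : vectType R).

Lemma free_cons_separated (W : vectType R) (phi : {linear V -> W})
    (u : V) (X : seq V) :
  phi u != 0 -> {in X, forall x, phi x = 0} -> free X -> free (u :: X).
Proof.
move=> phiu phiX freeX; rewrite free_cons freeX andbT.
apply/negP => uX.
have /subvP/(_ _ uX) : (<<X>> <= lker (linfun phi))%VS.
  by apply/span_subvP => x /phiX phix; rewrite memv_ker lfunE /= phix.
by rewrite memv_ker lfunE /= (negbTE phiu).
Qed.

Lemma affinely_independent_cons2 (W : vectType R) (phi : {linear V -> W})
    (c : W) (x u : V) (t : seq V) :
  phi u != c -> {in x :: t, forall y, phi y = c} ->
  affinely_independent (x :: t) -> affinely_independent [:: x, u & t].
Proof.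
move=> phiu phit; have phix := phit x (mem_head _ _).
apply: (free_cons_separated (phi := phi)).
  by rewrite linearB /= phix subr_eq0.
move=> _ /mapP[y yt ->].
by rewrite linearB /= phix phit ?subrr // inE yt orbT.
Qed.

Lemma size_affinely_independent (s : seq V) :
  affinely_independent s -> (size s <= (dim V).+1)%N.
Proof.
case: s => // x t; rewrite /= /free => /eqP.
rewrite size_map ltnS => <-; rewrite -dimvf; exact/dimvS/subvf.
Qed.

Lemma affinely_independent_map (W : vectType R) (phi : {linear V -> W})
    (s : seq V) :
  injective phi -> affinely_independent s -> affinely_independent (map phi s).
Proof.
move=> phi_inj; case: s => //= x t.
have -> : [seq y - phi x | y <- map phi t]
        = map (linfun phi) [seq y - x | y <- t].
  by rewrite -!map_comp; apply: eq_map => y /=; rewrite lfunE /= linearB.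
rewrite /free -limg_span limg_dim_eq ?size_map //.
suff /eqP -> : lker (linfun phi) == 0%VS by rewrite capv0.
by apply/lker0P => u v; rewrite !lfunE => /phi_inj.
Qed.

End AffineIndependence.

Section ConvexHull.
Variable R : realType.
Local Open Scope classical_set_scope.

Lemma sub_conv_hull (V : vectType R) (S : set V) : S `<=` conv_hull S.
Proof. by move=> x Sx C [_]; apply. Qed.

Lemma conv_hull_linear (V W : vectType R) (phi : {linear V -> W})
    (S : set V) (T : set W) (p : V) :
  (forall x, S x -> T (phi x)) -> conv_hull S p -> conv_hull T (phi p).
Proof.
move=> ST Sp C [cC TC].
apply: (Sp [set x | C (phi x)]); split; last by move=> x /ST/TC.
move=> x y l /[!inE] Cx Cy.
by have := cC (phi x) (phi y) l; rewrite !inE /= /conv /= linearD !linearZ; apply.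
Qed.

Lemma conv_hull_ge0 (V : vectType R) (phi : {linear V -> R^o})
    (S : set V) (p : V) :
  (forall x, S x -> 0 <= phi x) -> conv_hull S p -> 0 <= phi p.
Proof.
move=> S0 Sp; apply: (Sp [set x | 0 <= phi x]); split => //.
move=> x y l /[!inE] /= x0 y0; rewrite /conv /= linearD !linearZ /=.
have l1 : 0 <= unstable.onem l%:num :> R by rewrite subr_ge0; exact: le1.
exact: addr_ge0 (mulr_ge0 _ x0) (mulr_ge0 l1 y0).
Qed.

End ConvexHull.

Section Points.
Variables (R : realType) (I : finType).

Definition slack (c : I -> R) (p : point R I) : R^o :=
  p.1 - \sum_i c i * p.2 i.

Fact slack_is_linear c : linear (slack c).
Proof.
move=> r p q; rewrite /slack /= scalerBr scaler_sumr addrACA -opprD -big_split.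
congr (_ + _ - _); apply: eq_bigr => i _ /=.
by rewrite !ffunE mulrDr mulrCA.
Qed.

HB.instance Definition _ c :=
  GRing.isLinear.Build R (point R I) R^o _ (slack c) (slack_is_linear c).

Definition coordinate (i : I) (p : point R I) : R^o := p.2 i.

Fact coordinate_is_linear i : linear (coordinate i).
Proof. by move=> r p q; rewrite /coordinate /= !ffunE. Qed.

HB.instance Definition _ i :=
  GRing.isLinear.Build R (point R I) R^o _ (coordinate i)
    (coordinate_is_linear i).

Lemma slack_eq0 c (p : point R I) : (p.1 = \sum_i c i * p.2 i) <-> slack c p = 0.
Proof. by rewrite /slack; split=> [->|/subr0_eq//]; rewrite subrr. Qed.

Lemma dim_point : dim (point R I) = #|I|.+1.
Proof. exact: (congr1 S (muln1 _)). Qed.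

Definition support_point (w : R) (X : {set I}) : point R I :=
  (w, [ffun i => (i \in X)%:R]).

Lemma sum_support_point (b : I -> R) w X :
  \sum_i b i * (support_point w X).2 i = \sum_(i in X) b i.
Proof.
rewrite [RHS]big_mkcond; apply: eq_bigr => i _; rewrite ffunE.
by case: (i \in X); rewrite ?mulr1 ?mulr0.
Qed.

Lemma sum1_support_point w X : \sum_i (support_point w X).2 i = #|X|%:R.
Proof.
rewrite -sum1_card natr_sum -(sum_support_point (fun=> 1) w).
by under [RHS]eq_bigr do rewrite mul1r.
Qed.

Lemma zero_one_support_point w X i :
  (support_point w X).2 i = 0 \/ (support_point w X).2 i = 1.
Proof. by rewrite ffunE; case: (i \in X); [right|left]. Qed.

Lemma zero_one_pointE (p : point R I) :
  (forall i, p.2 i = 0 \/ p.2 i = 1) ->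
  p = support_point p.1 [set i | p.2 i == 1].
Proof.
case: p => w x /= x01; congr (_, _); apply/ffunP => i; rewrite ffunE inE.
by case: (x01 i) => ->; rewrite ?eqxx // eq_sym oner_eq0.
Qed.

Lemma support_point_P2 (f : R -> R) k (a : I -> R) w X :
  P2 f k a (support_point w X) <->
  f (\sum_(i in X) a i) <= w /\ (#|X| <= k)%N.
Proof.
split=> [[_]|[fX Xk]]; first by rewrite sum_support_point sum1_support_point ler_nat.
split; first exact: zero_one_support_point.
  by rewrite sum_support_point.
by rewrite sum1_support_point ler_nat.
Qed.

Lemma P1E (f : R -> R) k aL : @P1 R f k aL I = P2 f k (fun=> aL).
Proof.
by apply/seteqP; split=> p [x01 fp pk]; split=> //; move: fp; rewrite mulr_sumr.
Qed.

Lemma P2_affinely_independent_points (f : R -> R) k (a : I -> R) :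
  (1 <= k)%N -> f 0 = 0 ->
  exists s : seq (point R I), [/\ {in s, forall p, P2 f k a p},
    affinely_independent s & size s = #|I|.+2].
Proof.
move=> k1 f0; pose u i := support_point (f (a i)) [set i].
have u_coord i j : coordinate j (u i) = (j == i)%:R.
  by rewrite /coordinate ffunE inE.
exists [:: support_point 0 finset.set0, support_point 1 finset.set0 & map u (enum I)].
split; last by rewrite /= size_map -cardE.
  move=> p; rewrite !inE => /or3P[/eqP->|/eqP->|/mapP[i _ ->]].
  - by apply/support_point_P2; rewrite big_set0 f0 cards0.
  - by apply/support_point_P2; rewrite big_set0 f0 cards0 ler01.
  - by apply/support_point_P2; rewrite big_set1 cards1.
have coord0 w j : coordinate j (support_point w finset.set0) = 0.
  by rewrite /coordinate ffunE inE.
set x0 := support_point 0 _; set x1 := support_point 1 _.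
have -> : affinely_independent [:: x0, x1 & map u (enum I)]
        = affinely_independent (x0 :: (map u (enum I) ++ [:: x1])).
  apply/perm_free/perm_map; rewrite -cat1s; exact/permPl/perm_catC.
elim: (enum I) (enum_uniq I) => [_|i r IHr /= /andP[ir /IHr]].
  rewrite /= seq1_free; apply/eqP => /(congr1 fst)/eqP.
  by rewrite /= subr0 oner_eq0.
apply: (affinely_independent_cons2 (phi := coordinate i) (c := 0)).
  by rewrite /= u_coord eqxx oner_eq0.
move=> y; rewrite inE mem_cat => /orP[/eqP->|/orP[/mapP[j jr ->]|]].
- exact: coord0.
- by rewrite /= u_coord; case: eqP => // ij; rewrite ij jr in ir.
- by rewrite inE => /eqP->; exact: coord0.
Qed.

(* #|I|+1 tight points suffice: adding (1, 0), which is never tight, gives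
   affinely independent points of full dimension. *)
Lemma facet_defining_P2 (f : R -> R) k (a c : I -> R) (s : seq (point R I)) :
  (1 <= k)%N -> f 0 = 0 ->
  (forall X : {set I}, (#|X| <= k)%N ->
     \sum_(i in X) c i <= f (\sum_(i in X) a i)) ->
  {in s, forall p, conv_hull (P2 f k a) p /\ slack c p = 0} ->
  affinely_independent s -> size s = #|I|.+1 ->
  facet_defining (conv_hull (P2 f k a)) c.
Proof.
move=> k1 f0 valid tight indep sz_s; split.
  move=> p Sp; rewrite -subr_ge0; apply: (conv_hull_ge0 (phi := slack c)) Sp.
  move=> x Sx; have [/zero_one_pointE x01 _ _] := Sx.
  rewrite x01 in Sx *; have /support_point_P2[fX Xk] := Sx.
  rewrite /= /slack sum_support_point subr_ge0.
  exact: le_trans (valid _ Xk) fX.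
exists #|I|.+1%:Z; split; split.
- have [r [rS r_indep sz_r]] := P2_affinely_independent_points a k1 f0.
  exists r; split=> //; first by move=> p /rS; apply: sub_conv_hull.
  by rewrite sz_r; lia.
- by move=> r _ /size_affinely_independent; rewrite dim_point; lia.
- exists s; split=> //; last by rewrite sz_s; lia.
  by move=> p /tight[Sp /slack_eq0].
- case=> [_ _|x t tight_t indep_t]; first by rewrite /=; lia.
  have slack_t : {in x :: t, forall y, slack c y = 0}.
    by move=> y /tight_t[_ /slack_eq0].
  have slack1 : slack c (support_point 1 finset.set0) != 0.
    by rewrite /slack sum_support_point big_set0 subr0 oner_eq0.
  have := affinely_independent_cons2 slack1 slack_t indep_t.
  by move/size_affinely_independent; rewrite dim_point /=; lia.
Qed.

Lemma facet_defining_P1_tight (f : R -> R) k aL (c : I -> R) :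
  (1 <= k)%N -> f 0 = 0 -> facet_defining (conv_hull (@P1 R f k aL I)) c ->
  exists s : seq (point R I),
    [/\ {in s, forall p, conv_hull (P2 f k (fun=> aL)) p /\ slack c p = 0},
        affinely_independent s & size s = #|I|.+1].
Proof.
move=> k1 f0; rewrite P1E => -[_ [d [[_ d_max] [[s [s_tight s_indep sz_s]] _]]]].
have [r [rS r_indep sz_r]] :=
  P2_affinely_independent_points (fun=> aL) k1 f0.
have rd : (size r)%:Z <= d + 1.
  by apply: d_max r_indep => p /rS; apply: sub_conv_hull.
have s_slack : {in s, forall p, conv_hull (P2 f k (fun=> aL)) p /\ slack c p = 0}.
  by move=> p /s_tight[Sp /slack_eq0].
exists (take #|I|.+1 s); split.
- by move=> p /mem_take/s_slack.
- case: s s_indep {sz_s s_tight s_slack} => //= x t.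
  by rewrite -{1}(cat_take_drop #|I| t) map_cat => /catl_free.
- rewrite sz_r in rd; rewrite size_takel // -ltz_nat sz_s subrK.
  by move: rd; lia.
Qed.

End Points.

Section Extension.
Variables (R : realType) (I : finType) (A : {set I}).

Definition extend_by_zero (p : point R {i | i \in A}) : point R I :=
  (p.1, [ffun i => oapp (p.2 : {i | i \in A} -> R) 0 (insub i)]).

Fact extend_by_zero_is_linear : linear extend_by_zero.
Proof.
move=> r p q; congr (_, _); apply/ffunP => i; rewrite !ffunE /=.
by case: insub => [j|] /=; rewrite ?ffunE ?scaler0 ?addr0.
Qed.

HB.instance Definition _ :=
  GRing.isLinear.Build R (point R {i | i \in A}) (point R I) _ extend_by_zero
    extend_by_zero_is_linear.

Lemma extend_by_zero_val p (j : {i | i \in A}) :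
  (extend_by_zero p).2 (val j) = p.2 j.
Proof. by rewrite ffunE valK. Qed.

Lemma extend_by_zero_out p i : i \notin A -> (extend_by_zero p).2 i = 0.
Proof. by move=> iA; rewrite ffunE insubN. Qed.

Lemma extend_by_zero_inj : injective extend_by_zero.
Proof.
move=> p q pq; have pq1 : p.1 = q.1 := congr1 fst pq.
rewrite [p]surjective_pairing [q]surjective_pairing pq1; congr (_, _).
by apply/ffunP => j; rewrite -!extend_by_zero_val pq.
Qed.

Lemma sum_extend_by_zero (b : I -> R) p :
  \sum_i b i * (extend_by_zero p).2 i = \sum_j b (val j) * p.2 j.
Proof.
rewrite (bigID (mem A)) /= [X in _ + X]big1 ?addr0 => [|i iA]; last first.
  by rewrite extend_by_zero_out // mulr0.
rewrite (big_sub A) /=; apply: eq_bigr => j _.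
by rewrite extend_by_zero_val.
Qed.

Lemma slack_extend_by_zero (c : I -> R) p :
  slack c (extend_by_zero p) = slack (fun j => c (val j)) p.
Proof. by rewrite /slack sum_extend_by_zero. Qed.

Lemma extend_by_zero_P2 (f : R -> R) k (a : I -> R) p :
  P2 f k (fun j : {i | i \in A} => a (val j)) p -> P2 f k a (extend_by_zero p).
Proof.
move=> [p01 fp pk]; split=> [i||].
- have [iA|/extend_by_zero_out->] := boolP (i \in A); last by left.
  by rewrite -[i]/(val (exist (fun i => i \in A) i iA)) extend_by_zero_val.
- by rewrite sum_extend_by_zero.
- have := sum_extend_by_zero (fun=> 1) p.
  by under eq_bigr do rewrite mul1r; under [RHS]eq_bigr do rewrite mul1r; move=> ->.
Qed.

End Extension.

Section ConcaveSlopes.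
Variables (R : realType) (f : R -> R).
Hypothesis f_concave : concave_function f.

Lemma concave_chord x y z : x <= y -> y <= z ->
  (z - y) * f x + (y - x) * f z <= (z - x) * f y.
Proof.
move=> xy yz; have [xz|zx] := ltP x z; last first.
  have -> : y = x by lra.
  have -> : z = x by lra.
  lra.
have zx0 : 0 < z - x by lra.
have t0 : 0 <= (z - y) / (z - x) by apply: divr_ge0; lra.
have t1 : (z - y) / (z - x) <= 1 by rewrite ler_pdivrMr //; lra.
have := f_concave (Itv01 t0 t1) (mem_set I : x \in setT) (mem_set I : z \in setT).
rewrite /conv /= /conv /= /unstable.onem.
have -> : (z - y) / (z - x) *: (x : R^o) + (1 - (z - y) / (z - x)) *: (z : R^o) = y.
  by rewrite /GRing.scale /=; field; lra.
rewrite /GRing.scale /= => /(ler_wpM2l (ltW zx0)).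
have -> : (z - x) * ((z - y) / (z - x) * - f x + (1 - (z - y) / (z - x)) * - f z)
   = - ((z - y) * f x + (y - x) * f z) by field; lra.
lra.
Qed.

Lemma concave_slope x1 x2 y1 y2 :
  x1 <= x2 -> y1 <= y2 -> x1 <= y1 -> x2 <= y2 ->
  (f y2 - f y1) * (x2 - x1) <= (f x2 - f x1) * (y2 - y1).
Proof.
move=> x12 y12 xy1 xy2; have [d0|d0] := ltP x1 y2; last first.
  have -> : y2 = x1 by lra.
  have -> : y1 = x1 by lra.
  have -> : x2 = x1 by lra.
  lra.
have := concave_chord x12 xy2; have := concave_chord xy1 y12 => c1 c2.
have dp : 0 < y2 - x1 by lra.
rewrite -(ler_pM2r dp).
have : 0 <= ((y2 - x1) * f y1 - ((y2 - y1) * f x1 + (y1 - x1) * f y2)) * (x2 - x1).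
  by apply: mulr_ge0; lra.
have : 0 <= ((y2 - x1) * f x2 - ((y2 - x2) * f x1 + (x2 - x1) * f y2)) * (y2 - y1).
  by apply: mulr_ge0; lra.
lra.
Qed.

(* Unlike in [concave_slope], the differences are in units of [c]; the common
   factor [c] is cancelled, and both sides vanish when [c = 0]. *)
Lemma concave_slope_scaled (c d u1 u2 v1 v2 : R) :
  0 <= c -> u1 <= u2 -> v1 <= v2 ->
  u1 * c <= v1 * c + d -> u2 * c <= v2 * c + d ->
  (f (v2 * c + d) - f (v1 * c + d)) * (u2 - u1)
    <= (f (u2 * c) - f (u1 * c)) * (v2 - v1).
Proof.
rewrite le_eqVlt => /predU1P[<-|c0] u12 v12 uv1 uv2.
  by rewrite !mulr0 !subrr !mul0r.
have := @concave_slope (u1 * c) (u2 * c) (v1 * c + d) (v2 * c + d).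
rewrite !ler_pM2r // lerD2r ler_pM2r // => /(_ u12 v12 uv1 uv2).
rewrite opprD addrACA subrr addr0 -!mulrBl !mulrA ler_pM2r //.
Qed.

End ConcaveSlopes.

Section SortedSums.

Lemma sum_sorted_le (R : numDomainType) (g : nat -> R) (lo : nat) (s : seq nat) :
  (forall i, (lo <= i)%N -> g i.+1 <= g i) ->
  sorted ltn s -> all (leq lo) s ->
  \sum_(i <- s) g i <= \sum_(i < size s) g (lo + i)%N.
Proof.
elim: s lo => [|y s IHs] lo g_dec /=; first by rewrite big_nil big_ord0.
move=> ys /andP[lo_y _]; rewrite big_cons big_ord_recl addn0.
apply: lerD.
  elim: {ys IHs} y lo_y => [|y IHy]; first by rewrite leqn0 => /eqP->.
  rewrite leq_eqVlt => /predU1P[->//|]; rewrite ltnS => lo_y.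
  exact: le_trans (g_dec _ lo_y) (IHy lo_y).
rewrite (eq_bigr (fun i : 'I_(size s) => g (lo.+1 + i)%N)) => [|i _]; last first.
  by rewrite lift0 addSnnS.
apply: IHs; last 2 first.
- exact: path_sorted ys.
- apply: sub_all (order_path_min ltn_trans ys) => i; exact: leq_ltn_trans.
- by move=> i lo_i; apply: g_dec; apply: ltnW.
Qed.

Lemma sum_set_le (R : numDomainType) n (g : nat -> R) (lo : nat) (X : {set 'I_n}) :
  (forall i, (lo <= i)%N -> g i.+1 <= g i) ->
  {in X, forall i : 'I_n, (lo <= i)%N} ->
  \sum_(i in X) g i <= \sum_(i < #|X|) g (lo + i)%N.
Proof.
move=> g_dec loX; rewrite -big_enum -(big_map val predT g) cardE.
rewrite -(size_map val); apply: sum_sorted_le => //; last first.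
  by apply/allP => _ /mapP[i + ->]; rewrite mem_enum; apply: loX.
apply: (subseq_sorted ltn_trans _ (iota_ltn_sorted 0 n)).
rewrite -val_enum_ord; apply: map_subseq; rewrite enumT /enum_mem.
exact: filter_subseq.
Qed.

Lemma sum_first_higher (V : nmodType) n nL m p (g : nat -> V) :
  (m <= nL)%N -> (nL + p <= n)%N ->
  \sum_(i in first_items n m :|: higher_first_items n nL p) g i
    = \sum_(i < m) g i + \sum_(i < p) g (nL + i)%N.
Proof.
move=> m_nL np; rewrite (big_setID (first_items n m)) /=.
congr (_ + _).
  rewrite (big_ord_widen n g); last by lia.
  apply: eq_bigl => i; rewrite !inE; lia.
transitivity (\sum_(nL <= i < nL + p) g i); last first.
  rewrite -{1}[nL]add0n big_addn addKn big_mkord.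
  by apply: eq_bigr => i _; rewrite addnC.
rewrite (big_nat_widen _ _ n) // big_geq_mkord; apply: eq_bigl => i.
rewrite !inE; lia.
Qed.

End SortedSums.

Section SeparationCoefficients.
Variables (R : realType) (f : R -> R) (aL : R) (k i0 : nat).
Hypotheses (f_concave : concave_function f) (f_zero : f 0 = 0).
Hypotheses (aL_ge0 : 0 <= aL) (i0_lt_k : (i0 < k)%N).

Local Notation sep i := (separation_coef f aL k i0 i).
Local Notation psi := (psi f aL k i0).

Lemma rhoS i : rho f aL i.+1 = f (i.+1%:R * aL) - f (i%:R * aL).
Proof. by rewrite /rho -[in X in _ - X](natr1 i) addrK. Qed.

Let k_sub_i0 : 0 < k%:R - i0%:R :> R.
Proof. by rewrite subr_gt0 ltr_nat. Qed.

Lemma psi_mul : psi * (k%:R - i0%:R) = f (k%:R * aL) - f (i0%:R * aL).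
Proof. by rewrite mulfVK // gt_eqF. Qed.

Lemma concave_slope_nat (u1 u2 v1 v2 : nat) :
  (u1 <= u2)%N -> (v1 <= v2)%N -> (u1 <= v1)%N -> (u2 <= v2)%N ->
  (f (v2%:R * aL) - f (v1%:R * aL)) * (u2%:R - u1%:R)
    <= (f (u2%:R * aL) - f (u1%:R * aL)) * (v2%:R - v1%:R).
Proof.
move=> u12 v12 uv1 uv2; have := concave_slope_scaled f_concave (d := 0) aL_ge0.
by rewrite -[v2%:R * aL]addr0 -[v1%:R * aL]addr0; apply;
  rewrite ?addr0 ?ler_wpM2r ?ler_nat.
Qed.

Lemma separation_coefS_le i : sep i.+2 <= sep i.+1.
Proof.
have natSB m : m.+1%:R - m%:R = 1 :> R by rewrite -natr1 addrAC subrr add0r.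
rewrite /separation_coef; case: (ltngtP i.+1 i0) => [i_i0|//|i_i0].
- have := @concave_slope_nat i i.+1 i.+1 i.+2.
  by rewrite !rhoS !natSB !mulr1; apply.
- rewrite -(ler_pM2r k_sub_i0) psi_mul rhoS.
  have := @concave_slope_nat i i.+1 i0 k.
  by rewrite natSB mulr1; apply; lia.
Qed.

Lemma sum_separation_coef m :
  \sum_(i < m) sep i.+1
    = if (m <= i0)%N then f (m%:R * aL)
      else f (i0%:R * aL) + psi * (m%:R - i0%:R).
Proof.
elim: m => [|m IHm]; first by rewrite big_ord0 mul0r f_zero.
rewrite big_ord_recr /= IHm /separation_coef.
case: (ltngtP m i0) => [m_i0|m_i0|<-].
- by rewrite rhoS addrC subrK.
- by rewrite -addrA -[m.+1]addn1 natrD; congr (_ + _); ring.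
- by rewrite -[m.+1]addn1 natrD; congr (_ + _); ring.
Qed.

Lemma sum_separation_coef_k : \sum_(i < k) sep i.+1 = f (k%:R * aL).
Proof. by rewrite sum_separation_coef leqNgt i0_lt_k /= psi_mul addrC subrK. Qed.

(* The increment of f over [m * aL + d, q * aL + d] has a slope at most that
   over [i0 * aL, k * aL], that is psi, as far as m is at least i0; below i0
   the coefficients rho are themselves increments of f. *)
Lemma increment_le_sum_separation_coef (m q : nat) (d : R) :
  (m <= q)%N -> (q <= k)%N -> 0 <= d -> k%:R * aL <= q%:R * aL + d ->
  f (q%:R * aL + d) - f (m%:R * aL + d)
    <= \sum_(i < q) sep i.+1 - \sum_(i < m) sep i.+1.
Proof.
have below u v : (u <= v)%N -> (v <= i0)%N -> 0 <= d ->
    f (v%:R * aL + d) - f (u%:R * aL + d)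
      <= \sum_(i < v) sep i.+1 - \sum_(i < u) sep i.+1.
  move=> uv v_i0 d0; rewrite !sum_separation_coef v_i0 (leq_trans uv v_i0).
  move: uv; rewrite leq_eqVlt => /predU1P[->|uv]; first by rewrite !subrr.
  have vu0 : 0 < v%:R - u%:R :> R by rewrite subr_gt0 ltr_nat.
  rewrite -(ler_pM2r vu0); apply: concave_slope_scaled => //.
  - by rewrite ler_nat ltnW.
  - by rewrite ler_nat ltnW.
  - by rewrite lerDl.
  - by rewrite lerDl.
have above u v : (i0 <= u)%N -> (u <= v)%N -> 0 <= d ->
    k%:R * aL <= v%:R * aL + d ->
    f (v%:R * aL + d) - f (u%:R * aL + d)
      <= \sum_(i < v) sep i.+1 - \sum_(i < u) sep i.+1.
  move=> u_i0 uv d0 kv.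
  have -> : \sum_(i < v) sep i.+1 - \sum_(i < u) sep i.+1 = psi * (v%:R - u%:R).
    have sumE w : (i0 <= w)%N ->
        \sum_(i < w) sep i.+1 = f (i0%:R * aL) + psi * (w%:R - i0%:R).
      rewrite sum_separation_coef; case: ltngtP => // -> _.
      by rewrite subrr mulr0 addr0.
    by rewrite !sumE ?(leq_trans u_i0) //; ring.
  rewrite -(ler_pM2r k_sub_i0) mulrAC psi_mul.
  apply: concave_slope_scaled => //; rewrite ?ler_nat //; first exact: ltnW.
  by rewrite ler_wpDr // ler_wpM2r // ler_nat.
move=> mq qk d0 kq.
have [q_i0|i0_q] := leqP q i0; first exact: below.
have [i0_m|m_i0] := leqP i0 m; first exact: above.
have := lerD (above _ _ (leqnn _) (ltnW i0_q) d0 kq)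
  (below _ _ (ltnW m_i0) (leqnn _) d0).
lra.
Qed.

End SeparationCoefficients.

Section Lifting.
Variables (R : realType) (n k i0 : nat) (f : R -> R).
Variables (a : 'I_n -> R) (aL aH : R) (eta : 'I_n -> R).
Hypotheses (k_ge1 : (1 <= k)%N) (f_concave : concave_function f).
Hypotheses (f_zero : f 0 = 0) (aL_ge0 : 0 <= aL) (aL_lt_aH : aL < aH).
Local Notation lower := (lower_items a aL).
Variable nL : nat.
Hypothesis card_lower : #|lower| = nL.
Hypothesis a_values : codom a =i [:: aL; aH].
Hypothesis a_sorted : forall i : 'I_n, (i \in lower) = (i.+1 <= nL)%N.
Hypotheses (k_le_IL : (k <= nL)%N) (i0_lt_k : (i0 < k)%N).
Hypothesis eta_lifting : lower_SI_lifting f aL k i0 a aH eta.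

Local Notation sep i := (separation_coef f aL k i0 i).

Local Notation eta_value := (eta_of_support f aL k i0 a aH eta).

Lemma eta_first (j : 'I_n) : j.+1 = (nL + 1)%N ->
  eta j = eta_value (first_items n (k - 1)).
Proof. by have [lifting _ _] := eta_lifting; rewrite -card_lower; apply: lifting. Qed.

Lemma eta_step (s : nat) (j' j : 'I_n) :
  j = j'.+1 :> nat -> j.+1 = (nL + 1 + s)%N -> (1 <= s <= k - 1)%N ->
  eta j = Num.min (eta j')
    (eta_value (first_items n (k - 1 - s) :|: higher_first_items n nL s)).
Proof. by have [_ lifting _] := eta_lifting; rewrite -card_lower; apply: lifting. Qed.

Lemma eta_large (s : nat) (j' j : 'I_n) :
  j = j'.+1 :> nat -> j.+1 = (nL + 1 + s)%N -> (1 <= s)%N -> (k - 1 < s)%N ->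
  eta j = eta j'.
Proof. by have [_ _ lifting] := eta_lifting; rewrite -card_lower; apply: lifting. Qed.

Definition lower_SI_coef (j : 'I_n) : R :=
  if j \in lower then sep j.+1 else eta j.
Local Notation coef := lower_SI_coef.

Lemma a_lower i : i \in lower -> a i = aL.
Proof. by rewrite inE => /eqP. Qed.

Lemma a_higher i : i \notin lower -> a i = aH.
Proof.
move=> i_notin; have : a i \in [:: aL; aH] by rewrite -a_values codom_f.
by rewrite !inE; case/orP=> /eqP // ai; rewrite inE ai eqxx in i_notin.
Qed.

Lemma nL_lt_n : (nL < n)%N.
Proof.
have /codomP[i ai] : aH \in codom a by rewrite a_values !inE eqxx orbT.
have := a_sorted i; rewrite inE -ai gt_eqF //= => /esym/negbT; rewrite -leqNgt.
by move/leq_ltn_trans; apply.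
Qed.

(* Total and nonincreasing extensions to nat: beyond the last item, the
   coefficient of that item is repeated. *)
Fact last_item_proof : (n.-1 < n)%N.
Proof. by have := nL_lt_n; lia. Qed.
Definition last_item : 'I_n := Ordinal last_item_proof.
Definition eta_nat (i : nat) : R := eta (insubd last_item i).
Definition coef_nat (i : nat) : R := if (i < nL)%N then sep i.+1 else eta_nat i.
Definition weight_nat (i : nat) : R := if (i < nL)%N then aL else aH.

Lemma eta_natE (i : 'I_n) : eta_nat i = eta i.
Proof. by rewrite /eta_nat valKd. Qed.

Lemma coef_natE (i : 'I_n) : coef i = coef_nat i.
Proof. by rewrite /coef /coef_nat a_sorted eta_natE. Qed.

Lemma weight_natE (i : 'I_n) : a i = weight_nat i.
Proof.
by rewrite /weight_nat -a_sorted; case: ifPn => [/a_lower|/a_higher].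
Qed.

Lemma eta_of_supportE (X : {set 'I_n}) :
  eta_value X
    = f (aH + \sum_(i in X) a i) - \sum_(i in X) coef i.
Proof.
rewrite /eta_of_support card_lower -!addrA -!opprD; congr (_ - _).
rewrite !big_mkcondr -!big_split; apply: eq_bigr => i _ /=.
rewrite /coef a_sorted /separation_coef !ltnS.
case: (ltnP i i0) => i_i0; case: (ltnP i nL) => i_nL;
  rewrite ?addr0 ?add0r //; lia.
Qed.

Definition lifting_support s : {set 'I_n} :=
  first_items n (k - 1 - s) :|: higher_first_items n nL s.

Lemma eta_first_support (j : 'I_n) :
  j = nL :> nat -> eta j = eta_value (lifting_support 0).
Proof.
move=> j_nL; rewrite eta_first ?j_nL ?addn1 // /lifting_support subn0.
congr eta_value; apply/setP => i; rewrite !inE; lia.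
Qed.

Lemma eta_step_support (s : nat) (j' j : 'I_n) :
  j = j'.+1 :> nat -> j = (nL + s.+1)%N :> nat -> (s < k - 1)%N ->
  eta j = Num.min (eta j') (eta_value (lifting_support s.+1)).
Proof. by move=> jj' j_s s_k; apply: eta_step => //; rewrite j_s addn1. Qed.

Lemma higher_predecessor (s : nat) (j : 'I_n) : j = (nL + s.+1)%N :> nat ->
  exists2 j' : 'I_n, j = j'.+1 :> nat & j' = (nL + s)%N :> nat.
Proof.
move=> j_s; have s_n : (nL + s < n)%N by have := ltn_ord j; lia.
by exists (Ordinal s_n); rewrite ?j_s ?addnS.
Qed.

Lemma eta_le (s : nat) (j : 'I_n) :
  j = (nL + s)%N :> nat -> (s <= k - 1)%N -> eta j <= eta_value (lifting_support s).
Proof.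
case: s => [|s] j_s s_k; first by rewrite eta_first_support // j_s addn0.
have [j' jj' _] := higher_predecessor j_s.
by rewrite (eta_step_support jj' j_s s_k) ge_min lexx orbT.
Qed.

Lemma eta_attained (s : nat) (j : 'I_n) : j = (nL + s)%N :> nat ->
  ((s <= k - 1)%N /\ eta j = eta_value (lifting_support s))
  \/ exists2 j' : 'I_n, j = j'.+1 :> nat /\ (nL <= j')%N & eta j = eta j'.
Proof.
case: s => [|s] j_s; first by left; rewrite eta_first_support // j_s addn0.
have [j' jj' j'_s] := higher_predecessor j_s.
have nL_j' : (nL <= j')%N by rewrite j'_s leq_addr.
have [s_k|s_k] := ltnP s (k - 1); last first.
  right; exists j' => //; apply: (eta_large (s := s.+1)) jj' _ _ _; lia.
have := eta_step_support jj' j_s s_k; rewrite minEle; case: ifP => _ eta_j.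
  by right; exists j'.
by left.
Qed.

Lemma eta_nat_noninc i : (nL <= i)%N -> eta_nat i.+1 <= eta_nat i.
Proof.
move=> nL_i.
have [i_n|n_i] := ltnP i.+1 n; last first.
  rewrite {1}/eta_nat /insubd insubN -?leqNgt //=.
  have [i_n|{}n_i] := ltnP i n; last by rewrite /eta_nat /insubd insubN -?leqNgt.
  rewrite -[i in X in _ <= X]/(val (Ordinal i_n)) eta_natE.
  rewrite le_eqVlt; apply/orP; left; apply/eqP; congr eta.
  by apply: val_inj => /=; lia.
have i'_n : (i < n)%N by apply: ltnW.
rewrite -[i.+1]/(val (Ordinal i_n)) -[i in X in _ <= X]/(val (Ordinal i'_n)).
rewrite !eta_natE; have [s_k|s_k] := leqP (i.+1 - nL)%N (k - 1).
  rewrite (@eta_step (i.+1 - nL)%N (Ordinal i'_n) (Ordinal i_n) erefl) /=; [|lia..].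
  by rewrite ge_min lexx.
by rewrite (@eta_large (i.+1 - nL)%N (Ordinal i'_n) (Ordinal i_n) erefl) //=; lia.
Qed.

Lemma sum_coef_lower m : (m <= nL)%N ->
  \sum_(i < m) coef_nat i = \sum_(i < m) sep i.+1.
Proof.
move=> m_nL; apply: eq_bigr => i _; rewrite /coef_nat ifT //.
exact: leq_trans (ltn_ord i) m_nL.
Qed.

Lemma sum_weight_lower m : (m <= nL)%N -> \sum_(i < m) weight_nat i = m%:R * aL.
Proof.
move=> m_nL; rewrite (eq_bigr (fun=> aL)) => [|i _].
  by rewrite sumr_const card_ord mulr_natl.
by rewrite /weight_nat ifT // (leq_trans (ltn_ord i)).
Qed.

Lemma sum_weight_higher p : \sum_(i < p) weight_nat (nL + i) = p%:R * aH.
Proof.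
rewrite (eq_bigr (fun=> aH)) => [|i _].
  by rewrite sumr_const card_ord mulr_natl.
by rewrite /weight_nat ltnNge leq_addr.
Qed.

Lemma sum_coef_higher p :
  \sum_(i < p) coef_nat (nL + i) = \sum_(i < p) eta_nat (nL + i).
Proof. by apply: eq_bigr => i _; rewrite /coef_nat ltnNge leq_addr. Qed.

Lemma sum_lifting_support_weight s : (s <= k - 1)%N -> (nL + s < n)%N ->
  \sum_(i in lifting_support s) a i = (k - 1 - s)%:R * aL + s%:R * aH.
Proof.
move=> s_k s_n; under eq_bigr do rewrite weight_natE.
by rewrite sum_first_higher ?sum_weight_lower ?sum_weight_higher //; lia.
Qed.

Lemma sum_lifting_support_coef s : (s <= k - 1)%N -> (nL + s < n)%N ->
  \sum_(i in lifting_support s) coef i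
    = \sum_(i < k - 1 - s) sep i.+1 + \sum_(i < s) eta_nat (nL + i).
Proof.
move=> s_k s_n; under eq_bigr do rewrite coef_natE.
by rewrite sum_first_higher ?sum_coef_lower ?sum_coef_higher //; lia.
Qed.

Lemma prefix_valid p : (p <= k)%N -> (nL + p <= n)%N ->
  \sum_(i < k - p) sep i.+1 + \sum_(i < p) eta_nat (nL + i)
    <= f ((k - p)%:R * aL + p%:R * aH).
Proof.
case: p => [_ _|s s_k s_n].
  by rewrite subn0 big_ord0 mul0r !addr0 sum_separation_coef_k.
have s_k' : (s <= k - 1)%N by lia.
rewrite addnS in s_n.
have := @eta_le s (Ordinal s_n) erefl s_k'.
rewrite eta_of_supportE sum_lifting_support_weight // sum_lifting_support_coef //.
rewrite -eta_natE /= big_ord_recr /= -subnDA add1n.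
have -> : aH + ((k - s.+1)%:R * aL + s%:R * aH) = (k - s.+1)%:R * aL + s.+1%:R * aH.
  by rewrite -(natr1 s); ring.
lra.
Qed.

Lemma lower_SI_valid (X : {set 'I_n}) : (#|X| <= k)%N ->
  \sum_(i in X) coef i <= f (\sum_(i in X) a i).
Proof.
move=> Xk; set m := #|X :&: lower|; set p := #|X :\: lower|.
have mp : (m + p)%N = #|X| by rewrite cardsID.
have p_n : (nL + p <= n)%N.
  have : (#|X :\: lower| <= #|~: lower|)%N.
    by rewrite subset_leq_card // finset.setDE finset.subsetIr.
  by have := cardsC lower; rewrite card_ord card_lower -/p; lia.
have -> : \sum_(i in X) a i = m%:R * aL + p%:R * aH.
  rewrite (big_setID lower) /= (eq_bigr (fun=> aL)) => [|i]; last first.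
    by rewrite finset.in_setI => /andP[_ /a_lower].
  rewrite [X in _ + X](eq_bigr (fun=> aH)) => [|i]; last first.
    by rewrite finset.in_setD => /andP[/a_higher].
  by rewrite !sumr_const !mulr_natl.
have lower_le : \sum_(i in X :&: lower) coef i <= \sum_(i < m) sep i.+1.
  rewrite (eq_bigr (fun i : 'I_n => sep i.+1)) => [|i]; last first.
    by rewrite finset.in_setI /coef => /andP[_ ->].
  apply: (@sum_set_le _ _ (fun i => sep i.+1) 0) => // i _.
  exact: separation_coefS_le.
have higher_le : \sum_(i in X :\: lower) coef i <= \sum_(i < p) eta_nat (nL + i).
  rewrite (eq_bigr (fun i : 'I_n => eta_nat i)) => [|i]; last first.
    by rewrite finset.in_setD /coef eta_natE => /andP[/negbTE->].
  apply: sum_set_le; first exact: eta_nat_noninc.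
  by move=> i; rewrite finset.in_setD a_sorted -leqNgt => /andP[].
rewrite (big_setID lower) /=; apply: le_trans (lerD lower_le higher_le) _.
have p_k : (p <= k)%N by lia.
have := prefix_valid p_k p_n.
have := @increment_le_sum_separation_coef _ f aL k i0 f_concave f_zero aL_ge0
  i0_lt_k m (k - p) (p%:R * aH).
have -> : (m <= k - p)%N by lia.
rewrite leq_subr => /(_ isT isT).
have -> : 0 <= p%:R * aH by rewrite mulr_ge0 // ltW // (le_lt_trans aL_ge0).
have -> : k%:R * aL <= (k - p)%:R * aL + p%:R * aH.
  rewrite natrB // mulrBl -addrA lerDl addrC subr_ge0 ler_wpM2l //; exact: ltW.
move=> /(_ isT isT); lra.
Qed.

Lemma lifting_support_tight (s : nat) (j : 'I_n) :
  j = (nL + s)%N :> nat -> (s <= k - 1)%N -> eta j = eta_value (lifting_support s) ->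
  exists X : {set 'I_n}, [/\ j \in X, {in X, forall i : 'I_n, (i <= j)%N},
    (#|X| <= k)%N & f (\sum_(i in X) a i) = \sum_(i in X) coef i].
Proof.
move=> j_s s_k eta_j; have j_notin : j \notin lifting_support s.
  by rewrite !inE; lia.
have s_n : (nL + s < n)%N by rewrite -j_s.
exists (j |: lifting_support s); split.
- exact: setU11.
- by move=> i /[!inE] /predU1P[->//|]; lia.
- rewrite cardsU1 j_notin -sum1_card (sum_first_higher (fun=> 1%N)); try lia.
  by rewrite !sum1_card !card_ord; lia.
- rewrite !big_setU1 //= {1}/coef a_higher a_sorted -?leqNgt ?j_s ?leq_addr //.
  by rewrite ltnNge leq_addr /= eta_j eta_of_supportE subrK.
Qed.

Lemma lower_SI_tight_support (j : 'I_n) : (nL <= j)%N ->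
  exists X : {set 'I_n}, [/\ j \in X, {in X, forall i : 'I_n, (i <= j)%N},
    (#|X| <= k)%N & f (\sum_(i in X) a i) = \sum_(i in X) coef i].
Proof.
move=> nL_j; have [s j_s] : exists s, j = (nL + s)%N :> nat.
  by exists (j - nL)%N; rewrite subnKC.
elim: s j {nL_j} j_s => [|s IHs] j j_s.
all: have j_higher : j \notin lower by rewrite a_sorted -leqNgt; lia.
all: have [[s_k eta_j]|[j' [jj' nL_j'] eta_j]] := eta_attained j_s.
all: try by rewrite jj' in j_s; lia.
all: try exact: lifting_support_tight eta_j.
have j'_higher : j' \notin lower by rewrite a_sorted -leqNgt.
have [|X [j'X X_j' Xk tightX]] := IHs j'; first by lia.
have j_notin : j \notin X :\ j'.
  by rewrite !inE; apply/negP => /andP[_ /X_j']; rewrite jj' ltnn.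
exists (j |: X :\ j'); split.
- exact: setU11.
- move=> i /[!inE] /predU1P[->//|/andP[_ /X_j' i_j']].
  by rewrite jj' ltnW.
- by move: Xk; rewrite cardsU1 j_notin (cardsD1 j' X) j'X.
- rewrite !big_setU1 //= {1}/coef (negbTE j_higher) (a_higher j_higher) eta_j.
  move: tightX; rewrite !(big_setD1 j' j'X) /= {1}/coef (negbTE j'_higher).
  by rewrite (a_higher j'_higher).
Qed.

End Lifting.

Theorem corollary4p9p1 (R : realType) (n k i0 : nat) (f : R -> R)
    (a : 'I_n -> R) (aL aH : R) (eta : 'I_n -> R)
    (k_ge1 : (1 <= k)%N)
    (f_concave : concave_function f) (f_zero : f 0 = 0)
    (aL_ge0 : 0 <= aL) (aL_lt_aH : aL < aH)
    (a_values : codom a =i [:: aL; aH])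
    (a_sorted : forall i : 'I_n,
       (i \in lower_items a aL) = (i.+1 <= #|lower_items a aL|)%N)
    (k_le_IL : (k <= #|lower_items a aL|)%N)
    (i0_lt_k : (i0 < k)%N)
    (eta_lifting : lower_SI_lifting f aL k i0 a aH eta)
    (base_facet :
       facet_defining
         (conv_hull (@P1 R f k aL {i : 'I_n | i \in lower_items a aL}))
         (fun i => separation_coef f aL k i0 (val i).+1)) :
  facet_defining
    (conv_hull (@P2 R f k 'I_n a))
    (fun j => if j \in lower_items a aL
              then separation_coef f aL k i0 j.+1
              else eta j).
Proof.
set lower := lower_items a aL in a_sorted k_le_IL base_facet *.
set c := fun j => _.
have [nL card_lower] : exists nL, #|lower| = nL by exists #|lower|.
have sorted_nL (i : 'I_n) : (i \in lower) = (i < nL)%N.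
  by rewrite -card_lower a_sorted.
have k_nL : (k <= nL)%N by rewrite -card_lower.
have nL_n := nL_lt_n aL_lt_aH a_values sorted_nL.
have tight_points h : (nL + h <= n)%N -> exists x t,
    [/\ {in x :: t, forall p : point R 'I_n,
          [/\ conv_hull (P2 f k a) p, slack c p = 0
            & forall i : 'I_n, (nL + h <= i)%N -> p.2 i = 0]},
        affinely_independent (x :: t) & size t = (nL + h)%N].
  elim: h => [_|h IHh].
    have [s [s_tight s_indep sz_s]] :=
      facet_defining_P1_tight k_ge1 f_zero base_facet.
    have card_I : #|{: {i : 'I_n | i \in lower}}| = nL by rewrite card_sig.
    rewrite card_I in sz_s.
    case: s => // x t in s_tight s_indep sz_s *.
    exists (extend_by_zero x), (map (@extend_by_zero _ _ _) t); split.
    - rewrite -map_cons => _ /mapP[p /s_tight[Sp slack_p] ->]; split.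
      + apply: (conv_hull_linear (phi := @extend_by_zero R 'I_n lower)) Sp => q Sq.
        apply: extend_by_zero_P2.
        suff -> : (fun j : {i | i \in lower} => a (val j)) = fun=> aL by [].
        by apply: funext => j; rewrite (a_lower (valP j)).
      + rewrite slack_extend_by_zero -[RHS]slack_p; congr (slack _ p).
        by apply/funext => j; rewrite /c (valP j).
      + move=> i; rewrite addn0 => nL_i.
        by rewrite extend_by_zero_out // sorted_nL -leqNgt.
    - rewrite -map_cons.
      exact: affinely_independent_map (@extend_by_zero_inj _ _ _) s_indep.
    - by rewrite size_map addn0; case: sz_s.
  rewrite addnS => h_n; have [x [t [t_tight t_indep sz_t]]] := IHh (ltnW h_n).
  pose j := Ordinal h_n.
  have [X [jX X_j Xk tightX]] := lower_SI_tight_support k_ge1 aL_ge0 aL_lt_aH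
    card_lower a_values sorted_nL k_nL i0_lt_k eta_lifting
    (leq_addr h nL : (nL <= j)%N).
  pose u := support_point (f (\sum_(i in X) a i)) X.
  have u_tight : [/\ conv_hull (P2 f k a) u, slack c u = 0
      & forall i : 'I_n, (nL + h < i)%N -> u.2 i = 0].
    split; first by apply: sub_conv_hull; apply/support_point_P2.
      by apply/slack_eq0; rewrite sum_support_point; exact: tightX.
    by move=> i j_i; rewrite ffunE; case: (boolP (i \in X)) => // /X_j;
      rewrite leqNgt j_i.
  exists x, (u :: t); split; last by rewrite /= sz_t.
    move=> p; rewrite inE => /predU1P[->|].
      have [Sx slackx x0] := t_tight x (mem_head _ _).
      by split=> // i /ltnW/x0.
    rewrite inE => /predU1P[->//|pt].
    have [|Sp slackp p0] := t_tight p; first by rewrite inE pt orbT.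
    by split=> // i /ltnW/p0.
  apply: (affinely_independent_cons2 (phi := coordinate j) (c := 0)) t_indep.
    by rewrite /= /coordinate ffunE jX oner_eq0.
  by move=> p /t_tight[_ _ p0]; apply: p0.
have [|x [t [t_tight t_indep sz_t]]] := tight_points (n - nL)%N.
  by rewrite subnKC // ltnW.
apply: (facet_defining_P2 (s := x :: t)) => //.
- move=> X Xk.
  have := lower_SI_valid k_ge1 f_concave f_zero aL_ge0 aL_lt_aH card_lower
    a_values sorted_nL k_nL i0_lt_k eta_lifting Xk.
  by [].
- by move=> p /t_tight[].
- by rewrite /= sz_t subnKC ?card_ord // ltnW.
Qed.
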